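(* If $\mathcal{U}$ and $\mathcal{V}_i$, for $i\in\omega$, are Laver ultrafilters over $\omega$, then the ultrafilter $\mathcal{U}-\sum_{i\in\omega}\mathcal{V}_i$ on $\omega\times\omega$ is a Laver ultrafilter as well.
   Context: By an ultrafilter we always mean a non-principal ultrafilter. Laver ultrafilter: an ultrafilter $\mathcal{U}$ over a countably infinite set $N$ (such as $\omega$ or $\omega\times\omega$) is a Laver ultrafilter if for every sequence $\langle \mathcal{P}_n : n\in\omega\rangle$, where each $\mathcal{P}_n$ is a partition of $N$ into finitely many sets, there exists $x\in\mathcal{U}$ such that for all $n\in\omega$, $x$ has non-empty intersection with at most $n+1$ elements of $\mathcal{P}_n$. Given ultrafilters $\mathcal{U}$ and $\mathcal{V}_i$ ($i\in\omega$) over $\omega$, the ultrafilter $\mathcal{U}-\sum_{i\in\omega}\mathcal{V}_i$ on $\omega\times\omega$ consists of those $x\subseteq\omega\times\omega$ for which $\{i\in\omega : \{j\in\omega : \langle i,j\rangle\in x\}\in\mathcal{V}_i\}\in\mathcal{U}$. *)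

(* Defs.v *)
From mathcomp Require Import all_boot.
From mathcomp Require Import boolp classical_sets functions cardinality filter.

Set Implicit Arguments.
Unset Strict Implicit.
Unset Printing Implicit Defensive.

Local Open Scope classical_set_scope.
Local Open Scope card_scope.

Definition nonprincipal_ultrafilter (N : Type) (U : set_system N) : Prop :=
  UltraFilter U /\ forall a : N, U <> principal_filter a.

(* A partition is given as the set of its pieces, i.e., as a family of sets
   indexed by itself. *)
Definition finite_partition (N : Type) (P : set (set N)) : Prop :=
  finite_set P /\ partition P id [set: N].

(* Only meant to be used when N is countably infinite. *)
Definition laver_ultrafilter (N : Type) (U : set_system N) : Prop :=
  nonprincipal_ultrafilter U /\
  forall P : nat -> set (set N), (forall n, finite_partition (P n)) ->
    exists2 x : set N, U x &
      forall n, [set A | P n A /\ x `&` A !=set0] #<= `I_n.+1.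

Definition ultrafilter_sum (U : set_system nat) (V : nat -> set_system nat) :
    set_system (nat * nat) :=
  [set x | U [set i | V i [set j | x (i, j)]]].

(* Main.v *)
Require Import Defs.
From mathcomp Require Import all_boot.
From mathcomp Require Import boolp classical_sets functions cardinality filter.

(** The Laver property is easier to handle for colourings with finite ranges
    than for partitions: for every sequence of finite-valued colourings [f n]
    there is a set [x] of the ultrafilter on which [f n] takes at most [n.+1]
    values ([laver_colorings], [laver_of_colorings]).

    The bound [n.+1] may be replaced by [(e n).+1] for any [e] that takes every
    value finitely often ([laver_slow]): for each [m], gather into a single
    colouring finitely many of the [f n], among them all those with
    [e n <= m], and apply the Laver property to the sequence indexed by [m].

    For the sum, a colouring [f n] of the plane is first thinned out in each
    column [i], where [V i] gives a set [x i] and a base point [y i] in it such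
    that [f n] takes on [x i], besides its value at [y i], at most
    [n %/ 2 ^ i.+2] further values.  Then [U] thins out the set of columns: on
    some [A] in [U], the colour of the base point of the column takes at most
    [(n %/ 2).+1] values.  The set of all [(i, j)] with [i] in [A] and [j] in
    [x i] is in the sum, and the total number of values of [f n] there is at
    most [(n %/ 2).+1 + \sum_i n %/ 2 ^ i.+2 <= n.+1] ([sum_halves]). *)

Set Implicit Arguments.
Unset Strict Implicit.
Unset Printing Implicit Defensive.

Local Open Scope classical_set_scope.
Local Open Scope card_scope.

(** * The Laver property in terms of colourings *)

Lemma card_le_mem_seq (T : choiceType) (s : seq T) : [set` s] #<= `I_(size s).
Proof.
case: s => [|t s]; first by rewrite set_nil; exact: card_ge0.
apply: card_le_trans (card_image_le (nth t (t :: s)) _).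
by apply: subset_card_le => x /= /(nthP t).
Qed.

Lemma laver_colorings (N : Type) (W : set_system N) (T : choiceType)
    (f : nat -> N -> T) :
  laver_ultrafilter W -> (forall n, finite_set (range (f n))) ->
  exists2 x, W x &
    forall n, exists2 s : seq T, size s <= n.+1 & f n @` x `<=` [set` s].
Proof.
move=> [_ WL] ff.
pose P n : set (set N) := (fun t => f n @^-1` [set t]) @` range (f n).
have [n|x Wx xP] := WL P.
  split; first exact/finite_image/ff.
  split.
  - rewrite -subTset => p _; exists (f n @^-1` [set f n p]) => //.
    by exists (f n p) => //; exists p.
  - move=> _ _ [_ [p _ <-] <-] [_ [q _ <-] <-] [r /= [<-]].
    by move=> ->.
  - by move=> _ [_ [p _ <-] <-]; exists p.
exists x => // n.
have le_fx : f n @` x #<= `I_n.+1.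
  apply: card_le_trans (xP n).
  (* a fiber determines its colour, read off any of its points; [None] only
     serves the empty set *)
  pose color (A : set N) : option T :=
    if pselect (A !=set0) is left A0 then Some (f n (projT1 (cid A0))) else None.
  rewrite -card_ge_some.
  apply: card_le_trans (card_image_le color _).
  apply: subset_card_le => _ [_ [p xp <-] <-].
  have fpp : (f n @^-1` [set f n p]) !=set0 by exists p.
  exists (f n @^-1` [set f n p]).
    by split; [exists (f n p) => //; exists p | exists p].
  rewrite /color; case: pselect => // A0.
  by case: cid => q /= ->.
exists (finmap.enum_fset (fset_set (f n @` x))).
  exact: geq_card_fset_set.
move=> t xt /=.
have fin : finite_set (f n @` x).
  by apply: sub_finite_set (ff n) => _ [p _ <-]; exists p.
by rewrite -(fset_setK fin) in xt.
Qed.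

Lemma laver_of_colorings (N : Type) (W : set_system N) :
  nonprincipal_ultrafilter W ->
  (forall f : nat -> N -> set N, (forall n, finite_set (range (f n))) ->
    exists2 x, W x & forall n,
      exists2 s : seq (set N), size s <= n.+1 & f n @` x `<=` [set` s]) ->
  laver_ultrafilter W.
Proof.
move=> Wu colW; split=> // P Ppart.
have /(fun ex n => boolp.choice (ex n))/all_tag[f fP] :
    forall n p, exists A, P n A /\ A p.
  move=> n p; have [_ [cov _ _]] := Ppart n.
  have /= [A PA Ap] : cover (P n) id p by rewrite cov.
  by exists A.
have [n|x Wx xf] := colW f.
  apply: (sub_finite_set _ (proj1 (Ppart n))) => _ [p _ <-].
  by case: (fP n p).
exists x => // n; have [s les fs] := xf n.
apply: card_le_trans (_ : `I_(size s) #<= _); last by rewrite card_le_II.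
apply: card_le_trans (card_le_mem_seq s).
apply: subset_card_le => A [PA [p [xp Ap]]].
have [_ [_ triv _]] := Ppart n; have [Pf fp] := fP n p.
by apply: fs; exists p => //; apply: triv => //; exists p.
Qed.

Lemma finite_range_map (N : Type) (T : choiceType) (f : nat -> N -> T)
    (r : seq nat) :
  (forall n, finite_set (range (f n))) ->
  finite_set (range (fun p => [seq f n p | n <- r])).
Proof.
move=> ff; elim: r => [|n r IHr] /=; first exact: finite_image_cst.
exact: (finite_image11 cons (ff n) IHr).
Qed.

(** A value at a base point [y] of [x] is singled out, so that the bound
    [e n] counts only the other values of [f n]: in the sum, the values at the
    base points of all columns are controlled together, by [U]. *)
Lemma laver_slow (N : Type) (W : set_system N) (T : choiceType)
    (f : nat -> N -> T) (e : nat -> nat) :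
  laver_ultrafilter W -> (forall n, finite_set (range (f n))) ->
  (forall m, exists M, forall n, e n <= m -> n < M) ->
  exists x y, [/\ W x, x y & forall n,
    exists2 s : seq T, size s <= e n & f n @` x `<=` [set` f n y :: s]].
Proof.
move=> WL ff /boolp.choice [M eM].
have [m|x Wx xP] := laver_colorings
  (f := fun m p => [seq f n p | n <- iota 0 (M m)]) WL.
  exact: finite_range_map.
have [[Wu _] _] := WL.
have [y xy] := filter_ex Wx.
exists x, y; split=> // n.
have [s les fs] := xP (e n); have ltnM := eM _ _ (leqnn (e n)).
(* the colour [f n p] is read off the [n]-th entry of the gathered colour *)
pose s' := [seq nth (f n y) t n | t <- s].
have fs' p : x p -> f n p \in s'.
  move=> xp; apply/mapP; exists [seq f k p | k <- iota 0 (M (e n))].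
    by apply: fs; exists p.
  by rewrite (nth_map 0) ?size_iota// nth_iota.
exists (rem (f n y) s').
  by rewrite size_rem ?fs'// size_map -subn1 leq_subLR.
move=> _ [p xp <-] /=.
by rewrite -(perm_mem (perm_to_rem (fs' y xy))) fs'.
Qed.

(** * The sum is a non-principal ultrafilter *)

Lemma ultrafilter_sum_nonprincipal (U : set_system nat)
    (V : nat -> set_system nat) :
  nonprincipal_ultrafilter U -> (forall i, nonprincipal_ultrafilter (V i)) ->
  nonprincipal_ultrafilter (ultrafilter_sum U V).
Proof.
move=> [Uu Un] VN; have Vu i : UltraFilter (V i) by case: (VN i).
have sumP : ProperFilter (ultrafilter_sum U V).
  split; first by rewrite /ultrafilter_sum /= => /filter_ex[i /filter_ex[j]].
  split=> [|A B|A B AB]; rewrite /ultrafilter_sum /=.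
  - by apply: filterE => i; apply: filterE.
  - by apply: filterS2 => i; exact: filterI.
  - by apply: filterS => i; apply: filterS => j; exact: AB.
split.
  split=> // G GP FG; rewrite eqEsubset; split=> // A GA; apply: contrapT => nA.
  have GnA : G (~` A).
    apply: FG; have [//|] := in_ultra_setVsetC [set i | V i [set j | A (i, j)]] Uu.
    apply: filterS => i nVA.
    by have [|//] := in_ultra_setVsetC [set j | A (i, j)] (Vu i).
  by have /filter_ex[p []] : G (A `&` ~` A) by apply: filterI.
move=> [i j] sumij; apply: (Un i).
have Ui : U [set i].
  have : ultrafilter_sum U V [set (i, j)].
    by rewrite sumij; apply/principal_filterP.
  rewrite /ultrafilter_sum /=.
  by apply: filterS => k /filter_ex[l [->]].
apply/esym/max_filter; first exact: principal_filter_proper.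
move=> B UB; apply/principal_filterP.
by have /filter_ex[k [Bk <-]] : U (B `&` [set i]) by apply: filterI.
Qed.

(** * Counting the colours *)

Lemma sum_halves (k n : nat) : \sum_(i < k) n %/ 2 ^ i.+1 <= n.
Proof.
elim: k n => [|k IHk] n; first by rewrite big_ord0.
rewrite big_ord_recl expn1; under eq_bigr do rewrite expnS divnMA.
by apply: leq_trans (leq_add (leqnn _) (IHk _)) _; rewrite addnn -muln2 leq_divM.
Qed.

(** The dyadic bounds are slow enough to be summed over all columns within [n],
    yet each of them tends to infinity, as [laver_slow] demands. *)
Lemma divn_exp2_slow (k m : nat) :
  exists M, forall n, n %/ 2 ^ k <= m -> n < M.
Proof. by exists (m.+1 * 2 ^ k) => n; rewrite -ltn_divLR ?expn_gt0. Qed.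

(** The colours of the base points form a colouring of the index set of the
    columns, to which [U] applies.  The other colours of column [i] number
    at most [n %/ 2 ^ i.+2], so only the columns of index below [n] have any. *)
Lemma ultrafilter_sum_colorings (U : set_system nat)
    (V : nat -> set_system nat) (T : choiceType) (f : nat -> nat * nat -> T) :
  laver_ultrafilter U -> (forall i, laver_ultrafilter (V i)) ->
  (forall n, finite_set (range (f n))) ->
  exists2 x, ultrafilter_sum U V x & forall n,
    exists2 s : seq T, size s <= n.+1 & f n @` x `<=` [set` s].
Proof.
move=> UL VL ff.
have fin_sub (g : nat -> nat * nat) n : finite_set (range (f n \o g)).
  by apply: (sub_finite_set _ (ff n)) => _ [j _ <-]; exists (g j).
have /boolp.choice [x /boolp.choice [y xP]] : forall i, exists x y,
    [/\ V i x, x y & forall n, exists2 s : seq T, size s <= n %/ 2 ^ i.+2 &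
      (fun j => f n (i, j)) @` x `<=` [set` f n (i, y) :: s]].
  move=> i; apply: (laver_slow (f := fun n j => f n (i, j)) (VL i)).
    by move=> n; exact: (fin_sub (pair i)).
  exact: divn_exp2_slow.
have /(fun ex i => boolp.choice (ex i))/all_tag[sV sVP] : forall i n,
    exists s : seq T, size s <= n %/ 2 ^ i.+2 /\
      (fun j => f n (i, j)) @` x i `<=` [set` f n (i, y i) :: s].
  by move=> i n; have [_ _ /(_ n)[s]] := xP i; exists s.
have [||A [i0 [UA Ai0 AP]]] :=
  laver_slow (f := fun n i => f n (i, y i)) (e := fun n => n %/ 2 ^ 1) UL.
- by move=> n; exact: (fin_sub (fun i => (i, y i))).
- exact: divn_exp2_slow.
exists [set p | A p.1 /\ x p.1 p.2].
  rewrite /ultrafilter_sum /=; have [[Uu _] _] := UL.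
  apply: filterS UA => i Ai; have [[Vu _] _] := VL i.
  by have [Vx _ _] := xP i; apply: filterS Vx.
move=> n; have [sU leU sUP] := AP n.
exists (f n (i0, y i0) :: sU ++ flatten [seq sV i n | i <- iota 0 n]).
  rewrite /= ltnS size_cat size_flatten /shape -map_comp sumnE big_map.
  (* the term of index 0 is the share of [U], that of index [i.+1] the share of
     column [i] *)
  apply: leq_trans (sum_halves n.+1 n); rewrite big_ord_recl leq_add//.
  have -> : iota 0 n = index_iota 0 n by rewrite /index_iota subn0.
  rewrite big_mkord.
  by apply: leq_sum => i _; case: (sVP i n).
move=> _ [[i j] /= [Ai xj] <-].
have [sz] := sVP i n; move/(_ (f n (i, j))) => /=.
rewrite inE => /(_ _)/orP[|/eqP->|fs]; first by exists j.
  have := sUP (f n (i, y i)); rewrite /= -cat_cons mem_cat => -> //.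
  by exists i.
rewrite -cat_cons mem_cat; apply/orP; right.
apply/flatten_mapP; exists i => //; rewrite mem_iota add0n leq0n /=.
(* a column of index at least [n] has no further colours *)
rewrite ltnNge; apply/negP => leni.
move: sz; rewrite divn_small ?leqn0 ?size_eq0 => [/eqP s0|].
  by rewrite s0 in fs.
by apply: leq_ltn_trans leni _; rewrite (ltn_trans _ (ltn_expl _ _)).
Qed.

Theorem proposition3p4 (U : set_system nat) (V : nat -> set_system nat)
    (hU : laver_ultrafilter U) (hV : forall i : nat, laver_ultrafilter (V i)) :
  laver_ultrafilter (ultrafilter_sum U V).
Proof.
apply: laver_of_colorings => [|f]; last exact: ultrafilter_sum_colorings.
by apply: ultrafilter_sum_nonprincipal => [|i]; [case: hU | case: (hV i)].
Qed.
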